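(* Let $\varphi:\mathbb{S}^1\to\mathbb{R}^2$ be an $L$-biLipschitz function, and let $\varepsilon>0$. Then there exists a finitely piecewise linear, $(L+\varepsilon)$-biLipschitz function $\varphi_\varepsilon:\mathbb{S}^1\to\mathbb{R}^2$ such that $\|\varphi-\varphi_\varepsilon\|_{L^\infty}\le\varepsilon$.
   Context: $\mathbb{S}^1$ is the unit circle in $\mathbb{R}^2$, with $|x-y|$ the Euclidean (chord) distance between $x,y\in\mathbb{S}^1$. A function $f:\mathbb{S}^1\to\mathbb{R}^2$ is $L$-biLipschitz if $\frac1L|x-y|\le|f(x)-f(y)|\le L|x-y|$ for all $x,y\in\mathbb{S}^1$. Let $\pi:\mathbb{R}\to\mathbb{S}^1$ be the map $\pi(t)=t\ (\mathrm{mod}\ 2\pi)$, i.e. $\pi(t)$ is the point of the circle with angle $t$. For a function $\varphi:\mathbb{S}^1\to\mathbb{R}^2$ and real numbers $a<b$ with $b-a<2\pi$, let $\varphi^{ab}:[a,b]\to\mathbb{R}^2$ be $\varphi^{ab}(t)=\varphi(\pi(t))$. The function $\varphi$ is called finitely piecewise linear if for every such choice of $a,b$ the function $\varphi^{ab}$ is finitely piecewise linear, i.e. $[a,b]$ can be divided into finitely many subintervals on each of which $\varphi^{ab}$ is affine. *)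

(* Defs.v *)
From mathcomp Require Import all_boot all_order all_algebra.
From mathcomp Require Import all_classical all_reals all_analysis.

Set Implicit Arguments.
Unset Strict Implicit.
Unset Printing Implicit Defensive.

Import Order.TTheory GRing.Theory Num.Theory.
Import numFieldNormedType.Exports.

Local Open Scope classical_set_scope.
Local Open Scope ring_scope.

(* The plane is R * R; the library norm `|_| on R * R is the max norm, hence
   the explicit Euclidean norm. *)
Definition enorm (R : realType) (p : R * R) : R :=
  Num.sqrt (p.1 ^+ 2 + p.2 ^+ 2).

Definition circle (R : realType) : Type := {p : R * R | enorm p == 1}.

Lemma enorm_cos_sin (R : realType) (t : R) : enorm (cos t, sin t) == 1.
Proof. by rewrite /enorm /= cos2Dsin2 sqrtr1. Qed.

Definition circle_pt (R : realType) (t : R) : circle R :=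
  exist _ (cos t, sin t) (enorm_cos_sin t).

(* The condition 0 < L is implicit in writing 1 / L.  It has to be explicit
   here because 0^-1 = 0, so that constants would be 0-biLipschitz. *)
Definition bilipschitz (R : realType) (L : R) (f : circle R -> R * R) : Prop :=
  0 < L /\
  forall x y : circle R,
    L^-1 * enorm (val x - val y) <= enorm (f x - f y)
      <= L * enorm (val x - val y).

Definition affine_on (R : realType) (A : set R) (g : R -> R * R) : Prop :=
  exists u v : R * R, forall t, A t -> g t = (u.1 + t * v.1, u.2 + t * v.2).

(* The nodes of the subdivision of [a, b] are a :: s, with last node b. *)
Definition finitely_piecewise_linear_on (R : realType) (a b : R)
    (g : R -> R * R) : Prop :=
  exists s : seq R, itv_partition a b s /\
    forall i, (i < size s)%N -> affine_on `[nth b (a :: s) i, nth b s i] g.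

Definition finitely_piecewise_linear (R : realType)
    (f : circle R -> R * R) : Prop :=
  forall a b : R, a < b -> b - a < 2 * pi ->
    finitely_piecewise_linear_on a b (fun t => f (circle_pt t)).

(* The L^oo norm with respect to arc length, which is the image under
   circle_pt of the Lebesgue measure on [0, 2 pi[. *)
Definition Linfty_norm (R : realType) (f : circle R -> R * R) : \bar R :=
  Lnorm (mrestr (@lebesgue_measure R) (measurable_itv `[0, 2 * pi[))
    +oo%E (fun t => (enorm (f (circle_pt t)))%:E).

(* Main.v *)
(* Parametrize the circle by angle, so that phi becomes a periodic curve f with
   c (t - s) <= |f t - f s| <= L (t - s) locally, c slightly below 1 / L.
   Replacing a piece g|[a, b] of a curve by its chord never increases the
   Lipschitz constant.  It keeps a local lower bound c0 < c exactly as soon as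
   (a, b) minimizes the excess |g b - g a| - c0 (b - a) among the pairs around a
   given core interval: if P is on the chord AB and X = g t lies beyond B, then
   |X - P| >= |X - A| - |A - P| >= |A - B| + c0 (t - b) - |A - P|
   = |B - P| + c0 (t - b).
   Sweep from left to right, each time with a core of length h starting where the
   previous chord ends; a may fall inside the part already replaced.  An excess
   at most of order h forces b - a to be of order h, because the cross estimate
   |f t - g s| >= c1 (t - s) - O(h), c0 < c1 < c, between old and new parts
   survives each step with the same constant.  Hence finitely many chords reach
   once around, at distance O(h) from f, and one more chord of minimal excess
   closes the curve.  Pairs of points that are not close to each other are
   controlled by uniform closeness to f. *)
Require Import Defs.
From mathcomp Require Import all_boot all_order all_algebra.
From mathcomp Require Import all_classical all_reals all_analysis.
From mathcomp Require Import ring lra.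
Import Order.TTheory GRing.Theory Num.Theory.
Import numFieldNormedType.Exports.
Local Open Scope ring_scope.

Set Implicit Arguments.
Unset Strict Implicit.
Unset Printing Implicit Defensive.

(** * Chords of minimal excess *)

Definition eudist (R : realType) (p q : R * R) : R := enorm (p - q).

Section EuclideanDistance.
Context {R : realType}.
Implicit Types (p q r : R * R) (k : R).

Lemma enorm_ge0 p : 0 <= enorm p.
Proof. exact: sqrtr_ge0. Qed.

Lemma sqr_enorm p : enorm p ^+ 2 = p.1 ^+ 2 + p.2 ^+ 2.
Proof. by rewrite sqr_sqrtr // addr_ge0 ?sqr_ge0. Qed.

Lemma enormZ k p : enorm (k *: p) = `|k| * enorm p.
Proof. by rewrite /enorm /= !exprMn -mulrDr sqrtrM ?sqr_ge0// sqrtr_sqr. Qed.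

Lemma enormN p : enorm (- p) = enorm p.
Proof. by rewrite /enorm /= !sqrrN. Qed.

Lemma ler_enormD p q : enorm (p + q) <= enorm p + enorm q.
Proof.
have x0 := enorm_ge0 p; have y0 := enorm_ge0 q.
have X := sqr_enorm p; have Y := sqr_enorm q.
have XY0 : 0 <= enorm p * enorm q by rewrite mulr_ge0.
have cauchy : p.1 * q.1 + p.2 * q.2 <= enorm p * enorm q.
  have [/le_trans->//|ip0] := leP (p.1 * q.1 + p.2 * q.2) 0.
  rewrite -(@ler_pXn2r _ 2) ?nnegrE ?(ltW ip0)// exprMn X Y.
  (* Lagrange's identity: this square is the gap between the two squared sides of Cauchy-Schwarz. *)
  have : 0 <= (p.1 * q.2 - p.2 * q.1) ^+ 2 by exact: sqr_ge0.
  nra.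
rewrite -(@ler_pXn2r _ 2) ?nnegrE ?enorm_ge0 ?addr_ge0//.
have -> := sqr_enorm (p + q); rewrite /= [leRHS]sqrrD X Y; lra.
Qed.

Lemma eudist_ge0 p q : 0 <= eudist p q.
Proof. exact: enorm_ge0. Qed.

Lemma eudistC p q : eudist p q = eudist q p.
Proof. by rewrite /eudist -enormN opprB. Qed.

Lemma eudistxx p : eudist p p = 0.
Proof. by rewrite /eudist subrr -(scale0r p) enormZ normr0 mul0r. Qed.

Lemma eudist_triangle q p r : eudist p r <= eudist p q + eudist q r.
Proof. by rewrite /eudist -(subrKA q) ler_enormD. Qed.

Lemma ler_dist_eudist p p' q q' :
  `|eudist p q - eudist p' q'| <= eudist p p' + eudist q q'.
Proof.
have := eudist_triangle p' p q; have := eudist_triangle q' p' q.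
have := eudist_triangle p p' q'; have := eudist_triangle q p q'.
rewrite (eudistC q' q) (eudistC p' p) => *.
by rewrite ler_norml; apply/andP; split; lra.
Qed.

End EuclideanDistance.

(** * Replacing a piece of a curve by a chord *)

Section Bridge.
Context {R : realType}.
Implicit Types (g : R -> R * R) (a b s t K c k : R) (A B X : R * R).

Definition chord a b A B t : R * R := A + ((t - a) / (b - a)) *: (B - A).

Lemma chord_left a b A B : chord a b A B a = A.
Proof. by rewrite /chord subrr mul0r scale0r addr0. Qed.

Lemma chord_right a b A B : a < b -> chord a b A B b = B.
Proof.
by move=> ab; rewrite /chord divff ?subr_eq0 ?gt_eqF// scale1r addrC subrK.
Qed.

Lemma eudist_chord a b A B s t : a < b -> s <= t ->
  eudist (chord a b A B s) (chord a b A B t) = eudist A B / (b - a) * (t - s).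
Proof.
move=> ab st; rewrite /eudist /chord opprD addrACA subrr add0r -scalerBl.
rewrite enormZ -mulrBl -[enorm (B - A)]enormN !opprB.
have -> : s - a + (a - t) = s - t by ring.
rewrite normrM distrC [`|t - s|]ger0_norm ?subr_ge0//.
rewrite [`|_^-1|]gtr0_norm ?invr_gt0 ?subr_gt0//.
by rewrite [RHS]mulrC mulrA [RHS]mulrAC.
Qed.

(** Two curves are allowed because the sweep joins a modified curve to [f], while closing the seam
    joins a curve to its translate by one period. *)
Definition bridge g1 g2 a b t : R * R :=
  if t <= a then g1 t else if t <= b then chord a b (g1 a) (g2 b) t else g2 t.

Lemma bridgeL g1 g2 a b t : t <= a -> bridge g1 g2 a b t = g1 t.
Proof. by rewrite /bridge => ->. Qed.

Lemma bridgeM g1 g2 a b t : a <= t <= b ->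
  bridge g1 g2 a b t = chord a b (g1 a) (g2 b) t.
Proof.
rewrite /bridge => /andP[at_ ->]; case: ltgtP at_ => // -> _.
by rewrite chord_left.
Qed.

Lemma bridgeR g1 g2 a b t : a < b -> b <= t -> bridge g1 g2 a b t = g2 t.
Proof.
rewrite /bridge => ab bt; rewrite leNgt (lt_le_trans ab bt)/=.
by case: ltgtP bt => // <- _; rewrite chord_right.
Qed.

Definition lipschitz_line K g :=
  forall s t : R, s <= t -> eudist (g s) (g t) <= K * (t - s).

(** Gluing Lipschitz pieces that agree at the nodes keeps the constant. [K'] is separate from [K]
    since a chord between different curves may be steeper than both. *)
Lemma lipschitz_bridge K K' g1 g2 a b : a < b -> K <= K' ->
  lipschitz_line K g1 -> lipschitz_line K g2 ->
  eudist (g1 a) (g2 b) <= K' * (b - a) ->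
  lipschitz_line K' (bridge g1 g2 a b).
Proof.
move=> ab KK' L1 L2 LAB.
have lip' g : lipschitz_line K g -> lipschitz_line K' g.
  move=> L s t st; apply: le_trans (L _ _ st) _.
  by rewrite ler_wpM2r// subr_ge0.
have {}L1 := lip' _ L1; have {}L2 := lip' _ L2.
have Lc : lipschitz_line K' (chord a b (g1 a) (g2 b)).
  move=> s t st; rewrite eudist_chord// ler_wpM2r ?subr_ge0//.
  by rewrite ler_pdivrMr ?subr_gt0.
have glue g g' x : lipschitz_line K' g -> lipschitz_line K' g' -> g x = g' x ->
    lipschitz_line K' (fun t => if t <= x then g t else g' t).
  move=> Lg Lg' gx s t st.
  have [tx|xt] := leP t x; first by rewrite (le_trans st tx); exact: Lg.
  have [sx|xs] := leP s x; last exact: Lg'.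
  apply: le_trans (eudist_triangle (g x) _ _) _; rewrite {2}gx.
  have := Lg _ _ sx; have := Lg' _ _ (ltW xt); lra.
have Lcb := glue _ _ b Lc L2 (chord_right _ _ ab).
by apply: (glue _ _ a L1 Lcb); rewrite (ltW ab) chord_left.
Qed.

Lemma lipschitz_line_min K (F : R -> R) a b : a <= b ->
  (forall s t : R, `|F s - F t| <= K * `|s - t|) ->
  exists2 x, a <= x <= b & forall y, a <= y <= b -> F x <= F y.
Proof.
move=> ab LF.
have cF : continuous F.
  move=> x; apply/cvgrPdist_le => e e0; near=> y.
  apply: le_trans (LF _ _) _.
  have K1 : 0 < `|K| + 1 by rewrite ltr_wpDl.
  have : `|x - y| <= e / (`|K| + 1).
    by near: y; apply: cvgr_dist_le; [exact: cvg_id | rewrite divr_gt0].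
  rewrite ler_pdivlMr// => h.
  apply: le_trans h; rewrite mulrC ler_wpM2l//.
  by rewrite (le_trans (ler_norm K))// lerDl.
have [x xab xmin] := EVT_min ab (continuous_subspaceT cF).
by exists x => [|y yab]; [rewrite in_itv/= in xab | apply: xmin; rewrite in_itv].
Unshelve. all: by end_near. Qed.

Lemma lipschitz_line_dist K g s t : lipschitz_line K g ->
  eudist (g s) (g t) <= K * `|s - t|.
Proof.
move=> L; have [st|/ltW st] := leP s t; first by rewrite distrC ger0_norm ?subr_ge0// L.
by rewrite eudistC ger0_norm ?subr_ge0// L.
Qed.

(** Minimize in [t] for fixed [s], then in [s]: the partial minimum is again [(K + c)]-Lipschitz in
    [s], so the one-variable extreme value theorem suffices twice. *)
Lemma excess_min K c g1 g2 u v w : 0 <= w -> 0 <= c ->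
  lipschitz_line K g1 -> lipschitz_line K g2 ->
  exists a b, [/\ u - w <= a <= u, v <= b <= v + w &
    forall s t : R, u - w <= s <= u -> v <= t <= v + w ->
      eudist (g1 a) (g2 b) - c * (b - a) <= eudist (g1 s) (g2 t) - c * (t - s)].
Proof.
move=> w0 c0 L1 L2.
pose F s t := eudist (g1 s) (g2 t) - c * (t - s).
have LF s s' t t' : `|F s t - F s' t'| <= (K + c) * (`|s - s'| + `|t - t'|).
  have h := le_trans (ler_dist_eudist (g1 s) (g1 s') (g2 t) (g2 t'))
    (lerD (lipschitz_line_dist _ _ L1) (lipschitz_line_dist _ _ L2)).
  have -> : F s t - F s' t' = (eudist (g1 s) (g2 t) - eudist (g1 s') (g2 t'))
     + (c * (s - s') - c * (t - t')) by rewrite /F; ring.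
  apply: le_trans (ler_normD _ _) _; rewrite mulrDl [K * _]mulrDr.
  apply: lerD => //; apply: le_trans (ler_normB _ _) _.
  by rewrite !normrM (ger0_norm c0) mulrDr.
have minF s : {b | v <= b <= v + w & forall t, v <= t <= v + w -> F s b <= F s t}.
  apply: cid2; apply: (@lipschitz_line_min (K + c)) => [|t t']; first lra.
  by apply: le_trans (LF s s t t') _; rewrite subrr normr0 add0r.
pose be s := s2val (minF s).
have beI s : v <= be s <= v + w := s2valP (minF s).
have bemin s t : v <= t <= v + w -> F s (be s) <= F s t.
  exact: (s2valP' (minF s)).
have [||a aI amin] := @lipschitz_line_min (K + c) (fun s => F s (be s)) (u - w) u.
- lra.
- move=> s t.
  have := LF s t (be t) (be t); have := LF s t (be s) (be s).
  rewrite !subrr normr0 !addr0 !ler_norml.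
  have := bemin s _ (beI t); have := bemin t _ (beI s).
  move=> ? ? /andP[? ?] /andP[? ?]; apply/andP; split; lra.
exists a, (be a); split => // s t sI tI.
exact: le_trans (amin s sI) (bemin s t tI).
Qed.

(** The hypotheses based at [a] and at [b] express minimality of the excess against pairs sharing
    one end with the chord. A point of a curve and a point of the chord are compared through the far
    end of the chord, whose slope is at least [c]. *)
Lemma bridge_lower c k g1 g2 a b : a < b ->
  (forall s t : R, s <= t -> t <= a -> t - s <= k ->
    c * (t - s) <= eudist (g1 s) (g1 t)) ->
  (forall s t : R, b <= s -> s <= t -> t - s <= k ->
    c * (t - s) <= eudist (g2 s) (g2 t)) ->
  (forall s t : R, s <= a -> b <= t -> t - s <= k ->
    c * (t - s) <= eudist (g1 s) (g2 t)) ->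
  (forall s, a - k <= s <= a ->
    eudist (g1 a) (g2 b) + c * (a - s) <= eudist (g1 s) (g2 b)) ->
  (forall t, b <= t <= b + k ->
    eudist (g1 a) (g2 b) + c * (t - b) <= eudist (g1 a) (g2 t)) ->
  c * (b - a) <= eudist (g1 a) (g2 b) ->
  forall s t : R, s <= t -> t - s <= k ->
    c * (t - s) <= eudist (bridge g1 g2 a b s) (bridge g1 g2 a b t).
Proof.
move=> ab H1 H2 H12 HA HB HAB s t st tsk.
set A := g1 a in HA HB HAB *; set B := g2 b in HA HB HAB *.
set m := eudist A B / (b - a).
have cm : c <= m by rewrite ler_pdivlMr ?subr_gt0.
have mE : eudist A B = m * (b - a).
  by rewrite /m divfK // subr_eq0 gt_eqF.
have [ta|at_] := leP t a.
  by rewrite !bridgeL ?(le_trans st)//; apply: H1.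
have [bs|sb] := leP b s.
  by rewrite !bridgeR ?(le_trans bs)//; apply: H2.
have [sa|as_] := leP s a.
  have [bt|tb] := leP b t.
    by rewrite bridgeL// bridgeR//; apply: H12.
  rewrite bridgeL// bridgeM ?(ltW at_) ?(ltW tb)// -/A -/B.
  have := HA s; rewrite sa andbT => /(_ ltac:(lra)).
  have := eudist_triangle (chord a b A B t) (g1 s) B.
  have := eudist_chord A B ab (ltW tb); rewrite chord_right// -/m mE.
  nra.
rewrite bridgeM ?(ltW as_) ?(ltW sb)// -/A -/B.
have [bt|tb] := leP b t.
  rewrite bridgeR//.
  have := HB t; rewrite bt/= => /(_ ltac:(lra)).
  have := eudist_triangle (chord a b A B s) A (g2 t).
  have := eudist_chord A B ab (ltW as_); rewrite chord_left -/m mE.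
  nra.
rewrite bridgeM ?(ltW at_) ?(ltW tb)// eudist_chord// -/m.
by rewrite ler_wpM2r// subr_ge0.
Qed.

End Bridge.

(** * Piecewise affine approximation on the line *)

Section PiecewiseAffine.
Context {R : realType}.
Implicit Types (g : R -> R * R) (a b c d k t : R).

(** An inductive form, for which concatenation, translation and restriction are plain inductions;
    the strict [a < b] matches the strictly increasing nodes of [itv_partition]. *)
Inductive piecewise_affine g : R -> R -> Prop :=
| PiecewiseAffineNil a : piecewise_affine g a a
| PiecewiseAffineCons a b c : a < b -> affine_on `[a, b]%classic g ->
    piecewise_affine g b c -> piecewise_affine g a c.

Lemma affine_on_sub (X Y : set R) g g' : (X `<=` Y)%classic ->
  (forall t, X t -> g t = g' t) -> affine_on Y g -> affine_on X g'.
Proof.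
by move=> XY gg' [u [v uv]]; exists u, v => t Xt; rewrite -gg'// uv//; apply: XY.
Qed.

Lemma affine_on_chord (X : set R) a b A B : affine_on X (chord a b A B).
Proof.
exists (A - (a / (b - a)) *: (B - A)), ((b - a)^-1 *: (B - A)) => t _.
rewrite /chord [LHS]surjective_pairing/=; congr pair; rewrite /GRing.scale/=; ring.
Qed.

Lemma piecewise_affine_le g a b : piecewise_affine g a b -> a <= b.
Proof. by elim=> // {}a {}b c ab _ _; apply: le_trans; exact: ltW. Qed.

Lemma piecewise_affine_affine g a b : a <= b ->
  affine_on `[a, b]%classic g -> piecewise_affine g a b.
Proof.
rewrite le_eqVlt => /predU1P[-> _|ab h]; first exact: PiecewiseAffineNil.
exact: PiecewiseAffineCons ab h (PiecewiseAffineNil _ _).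
Qed.

Lemma piecewise_affine_cat g a b c :
  piecewise_affine g a b -> piecewise_affine g b c -> piecewise_affine g a c.
Proof.
by elim=> // {}a d e ad h _ ih /ih; exact: PiecewiseAffineCons.
Qed.

Lemma eq_piecewise_affine g g' a b : (forall t, a <= t <= b -> g t = g' t) ->
  piecewise_affine g a b -> piecewise_affine g' a b.
Proof.
move=> gg' gab; elim: gab gg' => [{}a|{}a d {}b ad h /piecewise_affine_le db ih] gg'.
  exact: PiecewiseAffineNil.
apply: (PiecewiseAffineCons ad).
  apply: affine_on_sub h => // t /=; rewrite in_itv/= => /andP[? ?].
  by apply: gg'; apply/andP; split => //; exact: le_trans db.
by apply: ih => t /andP[dt tb]; apply: gg'; rewrite tb (le_trans (ltW ad)).
Qed.

Lemma piecewise_affine_shift g g' a b k : (forall t, g' (t + k) = g t) ->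
  piecewise_affine g a b -> piecewise_affine g' (a + k) (b + k).
Proof.
move=> gg'; elim=> [{}a|{}a d {}b ad [u [v uv]] _ ih].
  exact: PiecewiseAffineNil.
apply: PiecewiseAffineCons ih; first by rewrite ltrD2r.
exists (u - k *: v), v => t /=; rewrite in_itv/= => atd.
rewrite -[t](subrK k) gg' uv /=; last by rewrite in_itv/=; lra.
by congr pair; rewrite /GRing.scale/=; ring.
Qed.

Lemma piecewise_affine_restrict g a b c d : a <= b -> b <= c -> c <= d ->
  piecewise_affine g a d -> piecewise_affine g b c.
Proof.
move=> ab bc cd gad; elim: gad b ab c bc cd => [{}a|{}a e {}d ae h _ ih] b ab c bc cd.
  have -> : b = c by lra.
  exact: PiecewiseAffineNil.
have affbc x y : b <= x -> y <= e -> affine_on `[x, y]%classic g.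
  move=> bx ye; apply: affine_on_sub h => // t /=; rewrite !in_itv/= => /andP[? ?].
  by apply/andP; split; lra.
have [ce|/ltW ec] := leP c e.
  by apply: piecewise_affine_affine => //; apply: affbc.
have [eb|/ltW be] := leP e b; first exact: ih.
apply: (@piecewise_affine_cat _ _ e); last exact: ih.
by apply: piecewise_affine_affine => //; apply: affbc.
Qed.

Lemma piecewise_affine_finitely_piecewise_linear g a b :
  piecewise_affine g a b -> finitely_piecewise_linear_on a b g.
Proof.
elim=> [{}a|{}a d {}b ad h _ [s [[sp sl] saff]]].
  by exists [::]; split => //; split.
exists (d :: s); split; first by split => //=; rewrite ad.
by move=> [|i]//= /saff.
Qed.

(** The chord may start to the left of [d]; then it covers all of [[d, b]] and nothing is asked of
    [g1]. *)
Lemma piecewise_affine_bridge g1 g2 a b d : a < b -> d < b ->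
  (d <= a -> piecewise_affine g1 d a) -> piecewise_affine (bridge g1 g2 a b) d b.
Proof.
move=> ab db pa1.
have aff x : a <= x -> affine_on `[x, b]%classic (bridge g1 g2 a b).
  move=> ax; apply: (affine_on_sub _ _ (affine_on_chord setT a b (g1 a) (g2 b))) => //.
  move=> t /=; rewrite in_itv/= => /andP[xt tb].
  by rewrite bridgeM// tb (le_trans ax).
have [da|/ltW ad] := leP d a; last exact/piecewise_affine_affine/aff/ad/ltW.
apply: piecewise_affine_cat (piecewise_affine_affine (ltW ab) (aff _ (lexx _))).
by apply: eq_piecewise_affine (pa1 da) => t /andP[_ ta]; rewrite bridgeL.
Qed.

End PiecewiseAffine.

(** * The sweep from left to right *)

Section Sweep.
Context {R : realType}.
Variables (f : R -> R * R) (K c0 gam kap rho h G D E : R).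

(* Part of [f] up to [x] has been replaced.  The additive error [G] does not
   grow from step to step; it is what bounds the length of the next chord. *)
Record sweep_state (g : R -> R * R) (x : R) : Prop := SweepState {
  sweep_eq : forall t, x <= t -> g t = f t;
  sweep_lipschitz : lipschitz_line K g;
  sweep_lower : forall s t : R, s <= t -> t - s <= kap ->
    c0 * (t - s) <= eudist (g s) (g t);
  sweep_cross : forall s t : R, s <= x -> x <= t -> t - s <= rho ->
    (c0 + gam) * (t - s) - G <= eudist (g s) (f t);
  sweep_close : forall s, eudist (g s) (f s) <= E;
  sweep_affine : piecewise_affine g 0 x }.

(* [D] bounds the length of a chord and [E] the distance to [f]. *)
Record sweep_constants : Prop := SweepConstants {
  _ : 0 <= c0; _ : 0 < gam; _ : 0 < kap; _ : 0 < h;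
  _ : 4 * kap + h <= rho; _ : c0 + 2 * gam <= K;
  _ : 0 <= G; _ : 2 * K * (K * h) <= gam * G;
  _ : G + K * h <= gam * D; _ : D <= kap;
  _ : 2 * K * D <= E; _ : E <= gam * kap;
  _ : lipschitz_line K f;
  _ : forall s t : R, s <= t -> t - s <= rho ->
    (c0 + 2 * gam) * (t - s) <= eudist (f s) (f t) }.

Lemma sweep_init : sweep_constants -> sweep_state f 0.
Proof.
case=> c0_ge0 gam_gt0 kap_gt0 h_gt0 rho_ge K_ge G_ge0 G_ge D_ge D_le E_ge E_le
   f_lipschitz f_lower; split=> //.
- move=> s t st tsk; apply: (@le_trans _ _ ((c0 + 2 * gam) * (t - s))).
    by rewrite ler_wpM2r ?subr_ge0//; lra.
  by apply: f_lower => //; lra.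
- move=> s t s0 t0 tsr.
  have st : 0 <= t - s by lra.
  have := f_lower _ _ (le_trans s0 t0) tsr; nra.
- move=> s; rewrite eudistxx; apply: le_trans E_ge.
  have : 0 <= K * h by nra.
  nra.
- exact: PiecewiseAffineNil.
Qed.

Lemma sweep_step g x : sweep_constants -> sweep_state g x ->
  exists g' x', x + h <= x' /\ sweep_state g' x'.
Proof.
move=> [c0_ge0 gam_gt0 kap_gt0 h_gt0 rho_ge K_ge G_ge0 G_ge
  D_ge D_le E_ge E_le f_lipschitz f_lower]
  [geq gL gl gx gE gpa].
have x0 := piecewise_affine_le gpa.
have K0 : 0 < K by lra.
(* The margin [2 * kap] is twice the scale: once [b - a <= D <= kap] is known, room [kap] remains on
   each side for testing minimality. A priori [b - a <= 4 * kap + h <= rho], so the cross estimate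
   applies to [a] and [b]. *)
have [a [b [/andP[aw ax] /andP[xb bw] ab_min]]] :=
  @excess_min _ K c0 g f x (x + h) (2 * kap) ltac:(lra) c0_ge0 gL f_lipschitz.
have ab : a < b by lra.
have bf : g b = f b by apply: geq; lra.
set A := g a in ab_min; set B := f b in ab_min bf.
have AB_K : eudist A B <= K * (b - a) by rewrite /A -bf; apply: gL; lra.
have AB_c : (c0 + gam) * (b - a) - G <= eudist A B by apply: gx; lra.
(* Minimality is tested on the core [(x, x + h)], both of whose ends lie on [f]. *)
have excess_le : eudist A B - c0 * (b - a) <= K * h.
  have xh := ab_min x (x + h) ltac:(lra) ltac:(lra).
  rewrite (geq x)// in xh.
  have := f_lipschitz x (x + h) ltac:(lra); nra.
have abD : b - a <= D.
  by rewrite -(ler_pM2l gam_gt0); lra.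
have HA s : a - kap <= s <= a -> eudist A B + c0 * (a - s) <= eudist (g s) B.
  move=> /andP[? ?]; have := ab_min s b ltac:(lra) ltac:(lra); lra.
have HB t : b <= t <= b + kap -> eudist A B + c0 * (t - b) <= eudist A (f t).
  move=> /andP[? ?]; have := ab_min a t ltac:(lra) ltac:(lra); lra.
have AB_c0 : c0 * (b - a) <= eudist A B.
  by rewrite /A -bf; apply: gl; lra.
have abD0 : 0 <= b - a by lra.
have KD : K * (b - a) <= K * D by rewrite ler_pM2l.
(* On [[a, b]] the chord and [f] are both [K]-Lipschitz and meet at [B], so they differ by at most
   [2 * K * D]. *)
have close s : eudist (bridge g f a b s) (f s) <= E.
  have /orP[sa|as_] := le_total s a; first by rewrite bridgeL.
  have /orP[bs|sb] := le_total b s.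
    by rewrite bridgeR// eudistxx; apply: le_trans (gE s); exact: eudist_ge0.
  rewrite bridgeM ?as_ ?sb//.
  have := eudist_triangle B (chord a b A B s) (f s).
  have := eudist_chord A B ab sb; rewrite chord_right// => ->.
  have := f_lipschitz _ _ sb; rewrite eudistC -/B.
  have : eudist A B / (b - a) * (b - s) <= K * (b - s).
    apply: ler_wpM2r; first lra.
    by rewrite ler_pdivrMr ?subr_gt0.
  have : K * (b - s) <= K * (b - a) by rewrite ler_pM2l//; lra.
  rewrite -/A -/B; lra.
exists (bridge g f a b), b; split; first lra.
split=> //.
- by move=> t bt; rewrite bridgeR.
- exact: (@lipschitz_bridge _ K).
- apply: bridge_lower => //.
  + by move=> s t st ta tsk; apply: gl.
  + by move=> s t bs st tsk; rewrite -!geq; [apply: gl| lra | lra].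
  + by move=> s t sa bt tsk; rewrite -geq; [apply: gl|]; lra.
- move=> s t sb bt tsr.
  have st0 : 0 <= t - s by lra.
  (* For [t - s >= kap] the spare [gam * (t - s)] in the lower bound of [f] exceeds the uniform
     error [E]. *)
  have /orP[far|near] := le_total kap (t - s).
    have := f_lower _ _ (le_trans sb bt) tsr.
    have := eudist_triangle (bridge g f a b s) (f s) (f t).
    have := close s; rewrite eudistC.
    have : gam * kap <= gam * (t - s) by rewrite ler_pM2l.
    lra.
  have /orP[sa|as_] := le_total s a; first by rewrite bridgeL//; apply: gx => //; lra.
  rewrite bridgeM ?as_//.
  set m := eudist A B / (b - a).
  have mE : eudist A B = m * (b - a) by rewrite /m divfK // subr_eq0 gt_eqF.
  have mK : m <= K by rewrite ler_pdivrMr ?subr_gt0.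
  (* A chord of small slope is compared with its left end, a steep one is
     short enough to be compared with its right end, which lies on [f]. *)
  have /orP[mc|cm] := le_total m (c0 + gam).
    have := gx a t ltac:(lra) ltac:(lra) ltac:(lra).
    have := eudist_triangle (chord a b A B s) A (f t).
    have := eudist_chord A B ab as_; rewrite chord_left -/m => ->.
    rewrite -/A -/B.
    have : m * (s - a) <= (c0 + gam) * (s - a) by rewrite ler_wpM2r// subr_ge0.
    lra.
  (* The excess is [(m - c0) * (b - a)], with [m - c0 >= gam]. *)
  have short : gam * (b - a) <= K * h.
    have : (c0 + gam) * (b - a) <= m * (b - a) by rewrite ler_wpM2r.
    lra.
  have := eudist_triangle (chord a b A B s) B (f t).
  rewrite [eudist B (chord _ _ _ _ _)]eudistC.
  have := eudist_chord A B ab sb; rewrite chord_right// -/m => ->.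
  have := f_lower b t bt ltac:(lra); rewrite -/A -/B.
  have mb : m * (b - s) <= K * (b - a).
    have : m * (b - s) <= K * (b - s) by rewrite ler_wpM2r// subr_ge0.
    have : K * (b - s) <= K * (b - a) by rewrite ler_pM2l//; lra.
    lra.
  have cb : (c0 + gam) * (b - s) <= K * (b - a).
    have : (c0 + gam) * (b - s) <= K * (b - s).
      by rewrite ler_wpM2r ?subr_ge0//; lra.
    have : K * (b - s) <= K * (b - a) by rewrite ler_pM2l//; lra.
    lra.
  (* Going through [B] costs at most [2 * K * (b - a)], whatever the error of earlier steps was; the
     small-slope case inherits [G] unchanged. Hence errors do not accumulate. *)
  have Gb : 2 * K * (b - a) <= G.
    rewrite -(ler_pM2l gam_gt0); apply: le_trans G_ge.
    by rewrite mulrCA ler_pM2l// mulr_gt0.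
  have : 0 <= gam * (t - b) by rewrite mulr_ge0 ?subr_ge0// ltW.
  lra.
- apply: piecewise_affine_bridge => //; first lra.
  by move=> a0; apply: piecewise_affine_restrict gpa => //; lra.
Qed.

End Sweep.

Lemma piecewise_affine_line_approximation (R : realType) (f : R -> R * R)
    (K c0 gam rho E T : R) :
  0 <= c0 -> 0 < gam -> 0 < rho -> 0 < E -> 0 <= T -> c0 + 2 * gam <= K ->
  lipschitz_line K f ->
  (forall s t, s <= t -> t - s <= rho ->
    (c0 + 2 * gam) * (t - s) <= eudist (f s) (f t)) ->
  exists g, [/\ lipschitz_line K g,
    forall s t, s <= t -> t - s <= rho / 8 -> c0 * (t - s) <= eudist (g s) (g t),
    forall s, eudist (g s) (f s) <= E & piecewise_affine g 0 T].
Proof.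
move=> c00 gam0 rho0 E0 T0 cK fL fl.
have K0 : 0 < K by lra.
pose kap := rho / 8; have kap0 : 0 < kap by rewrite /kap; lra.
pose E' := Num.min E (gam * kap).
have E'0 : 0 < E' by rewrite lt_min E0 mulr_gt0.
(* [G] and [D] are taken proportional to [h], so that one small [h] meets all the constraints. *)
pose G1 := 2 * K * K / gam; pose D1 := (G1 + K) / gam.
have G10 : 0 < G1 by rewrite !(mulr_gt0, divr_gt0, invr_gt0).
have D10 : 0 < D1 by rewrite divr_gt0// addr_gt0.
pose h := Num.min kap (Num.min kap (E' / (2 * K)) / D1).
have h0 : 0 < h by rewrite !lt_min kap0 divr_gt0// lt_min kap0 divr_gt0// mulr_gt0.
have hD : h * D1 <= Num.min kap (E' / (2 * K)).
  by rewrite -ler_pdivlMr// ge_min lexx orbT.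
have C : sweep_constants f K c0 gam kap rho h (G1 * h) (D1 * h) E'.
  split=> //.
  - have : h <= kap by rewrite ge_min lexx.
    by rewrite /kap; lra.
  - by rewrite mulr_ge0 ?ltW.
  - by rewrite /G1 [leRHS]mulrA [gam * _]mulrC divfK ?gt_eqF// !mulrA.
  - by rewrite /D1 [leRHS]mulrA [gam * _]mulrC divfK ?gt_eqF// mulrDl.
  - by rewrite mulrC; apply: le_trans hD _; rewrite ge_min lexx.
  - rewrite mulrC -ler_pdivlMr ?mulr_gt0// mulrC.
    by apply: le_trans hD _; rewrite ge_min lexx orbT.
  - by rewrite ge_min lexx orbT.
have sweep n : exists g x, n%:R * h <= x /\
    sweep_state f K c0 gam kap rho (G1 * h) E' g x.
  elim: n => [|n [g [x [nx gx]]]].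
    by exists f, 0; rewrite mul0r; split => //; exact: sweep_init C.
  have [g' [x' [xx' gx']]] := sweep_step C gx.
  by exists g', x'; split => //; rewrite -natr1 mulrDl mul1r; lra.
(* Each step advances by at least [h], so more than [T / h] steps pass [T]. *)
have [g [x [nx [_ gL gl _ gE gpa]]]] := sweep (Num.truncn (T / h)).+1.
exists g; split => //.
- by move=> s; apply: le_trans (gE s) _; rewrite ge_min lexx.
- apply: piecewise_affine_restrict gpa => //; apply: le_trans nx.
  by rewrite -ler_pdivrMr// ltW// truncnS_gt.
Qed.

(** * Periodic curves *)

(** A chord of minimal excess near [T] joins [g] to its translate [g2] by [T]. Agreement with the
    translate is kept only on an overlap of length [rho / 8], the scale of the local lower bound. *)
Lemma close_seam (R : realType) (f g : R -> R * R) (K c0 gam rho T E1 D E : R) :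
  0 <= c0 -> 0 < gam -> 0 < rho -> rho <= T -> c0 + 2 * gam <= K ->
  0 < E1 -> E1 * K + 2 * gam * E1 <= gam * (gam * D) -> D <= rho / 8 ->
  (2 * K + gam) * D + E1 <= E ->
  lipschitz_line K f -> (forall t, f (t - T) = f t) ->
  (forall s t, s <= t -> t - s <= rho ->
    (c0 + 2 * gam) * (t - s) <= eudist (f s) (f t)) ->
  lipschitz_line K g ->
  (forall s t, s <= t -> t - s <= rho / 8 -> c0 * (t - s) <= eudist (g s) (g t)) ->
  (forall s, eudist (g s) (f s) <= E1) -> piecewise_affine g 0 T ->
  exists G b, [/\ lipschitz_line (K + gam) G,
    forall s t, s <= t -> t - s <= rho / 8 -> c0 * (t - s) <= eudist (G s) (G t),
    forall s, eudist (G s) (f s) <= E,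
    forall t, b + T <= t <= b + T + rho / 8 -> G t = G (t - T)
    & piecewise_affine G b (b + T)].
Proof.
move=> c00 gam0 rho0 rhoT cK E10 D_ge D_le E_ge fL fT fl gL gl gE gpa.
have K0 : 0 < K by lra.
pose g2 t := g (t - T).
have g2L : lipschitz_line K g2.
  by move=> s t st; have := gL (s - T) (t - T) ltac:(lra); rewrite opprB addrA subrK.
have g2E s : eudist (g2 s) (f s) <= E1 by rewrite /g2 -[f s]fT.
have cross_upper s t : s <= t -> eudist (g s) (g2 t) <= K * (t - s) + 2 * E1.
  move=> st; have := fL _ _ st; have := gE s; have := g2E t.
  have := eudist_triangle (f s) (g s) (g2 t); have := eudist_triangle (f t) (f s) (g2 t).
  rewrite [eudist (f t) (g2 t)]eudistC; lra.
have cross_lower s t : s <= t -> t - s <= rho ->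
    (c0 + 2 * gam) * (t - s) - 2 * E1 <= eudist (g s) (g2 t).
  move=> st str; have := fl _ _ st str; have := gE s; have := g2E t.
  have := eudist_triangle (g s) (f s) (f t); have := eudist_triangle (g2 t) (g s) (f t).
  rewrite [eudist (f s) (g s)]eudistC; lra.
(* Half-length of the core around [T]. Across a gap of at least [2 * r], [gam] times the gap pays
   for the error [2 * E1] of using [g] and [g2] in place of [f]. *)
pose r := E1 / gam.
have r0 : 0 < r by rewrite divr_gt0.
have rE : gam * r = E1 by rewrite /r mulrC divfK// gt_eqF.
have rD : r * K + 2 * E1 <= gam * D.
  rewrite -(ler_pM2l gam0); apply: le_trans D_ge.
  by rewrite mulrDr mulrA rE; lra.
have r2D : 2 * r <= D.
  have : 0 < r * K by rewrite mulr_gt0.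
  by rewrite -(ler_pM2l gam0); lra.
clearbody r.
have [a [b [/andP[aw ar] /andP[rb bw] ab_min]]] :=
  @excess_min _ K c0 g g2 (T - r) (T + r) (rho / 4) ltac:(lra) c00 gL g2L.
have ab : a < b by lra.
have abD : b - a <= D.
  rewrite -(ler_pM2l gam0).
  have := cross_lower a b (ltW ab) ltac:(lra).
  have := cross_upper (T - r) (T + r) ltac:(lra).
  have := ab_min (T - r) (T + r) ltac:(lra) ltac:(lra).
  have : 0 <= c0 * (T + r - (T - r)) by rewrite mulr_ge0//; lra.
  lra.
have gamr x : 2 * r <= x -> 2 * E1 <= gam * x.
  by move=> rx; have := ler_wpM2l (ltW gam0) rx; lra.
have AB_c : c0 * (b - a) <= eudist (g a) (g2 b).
  have := cross_lower a b (ltW ab) ltac:(lra); have := gamr (b - a) ltac:(lra); lra.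
have AB_K : eudist (g a) (g2 b) <= (K + gam) * (b - a).
  have := cross_upper a b (ltW ab); have := gamr (b - a) ltac:(lra); lra.
(* The chosen period [[b - T, b]] ends with the seam chord; what precedes the chord there is [g] on
   a part of [[0, T]]. *)
exists (bridge g g2 a b), (b - T); rewrite subrK; split.
- by apply: (@lipschitz_bridge _ K (K + gam)) => //; lra.
- apply: bridge_lower => //.
  + by move=> s t st _; exact: gl.
  + move=> s t _ st tsr; have := gl (s - T) (t - T) ltac:(lra).
    by rewrite opprB addrA subrK; apply.
  + move=> s t sa bt tsr.
    have := cross_lower s t ltac:(lra) ltac:(lra); have := gamr (t - s) ltac:(lra).
    lra.
  + by move=> s /andP[? ?]; have := ab_min s b ltac:(lra) ltac:(lra); lra.
  + by move=> t /andP[? ?]; have := ab_min a t ltac:(lra) ltac:(lra); lra.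
- move=> s.
  have D0 : 0 <= (2 * K + gam) * D by rewrite mulr_ge0//; lra.
  have /orP[sa|as_] := le_total s a.
    by rewrite bridgeL//; have := gE s; lra.
  have /orP[bs|sb] := le_total b s.
    by rewrite bridgeR//; have := g2E s; lra.
  rewrite bridgeM ?as_//.
  have := eudist_triangle (g2 b) (chord a b (g a) (g2 b) s) (f s).
  have := eudist_chord (g a) (g2 b) ab sb; rewrite chord_right// => ->.
  have := eudist_triangle (f b) (g2 b) (f s); have := g2E b.
  have := fL _ _ sb; rewrite [eudist (f b) _]eudistC.
  have : eudist (g a) (g2 b) / (b - a) * (b - s) <= (K + gam) * (b - s).
    by apply: ler_wpM2r; [lra | rewrite ler_pdivrMr ?subr_gt0].
  have : (2 * K + gam) * (b - s) <= (2 * K + gam) * D by apply: ler_wpM2l; lra.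
  lra.
- move=> t /andP[bt tb].
  by rewrite bridgeR// bridgeL//; lra.
- apply: piecewise_affine_bridge => //; first lra.
  by move=> ba; apply: piecewise_affine_restrict gpa => //; lra.
Qed.

Lemma periodic_piecewise_affine_approximation (R : realType) (f : R -> R * R)
    (K c0 gam rho E T : R) :
  0 <= c0 -> 0 < gam -> 0 < rho -> 0 < E -> rho <= T -> c0 + 2 * gam <= K ->
  lipschitz_line K f -> (forall t, f (t - T) = f t) ->
  (forall s t, s <= t -> t - s <= rho ->
    (c0 + 2 * gam) * (t - s) <= eudist (f s) (f t)) ->
  exists G b, [/\ lipschitz_line (K + gam) G,
    forall s t, s <= t -> t - s <= rho / 8 -> c0 * (t - s) <= eudist (G s) (G t),
    forall s, eudist (G s) (f s) <= E,
    forall t, b + T <= t <= b + T + rho / 8 -> G t = G (t - T)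
    & piecewise_affine G b (b + T)].
Proof.
move=> c00 gam0 rho0 E0 rhoT cK fL fT fl.
have K0 : 0 < K by lra.
(* With [D := E1 * q] the lower constraint on [D] in [close_seam] is an equality, and a small [E1]
   gives the upper ones. *)
pose q := (K + 2 * gam) / gam / gam.
have q0 : 0 < q by rewrite !divr_gt0//; lra.
pose D0 := Num.min (rho / 8) (E / 2 / (2 * K + gam)).
have D00 : 0 < D0 by rewrite lt_min !divr_gt0//; lra.
pose E1 := Num.min (E / 2) (D0 / q).
have E10 : 0 < E1 by rewrite lt_min (divr_gt0 D00 q0) divr_gt0.
have D1 : E1 * q <= D0 by rewrite -ler_pdivlMr// ge_min lexx orbT.
have [g [gL gl gE gpa]] :=
  @piecewise_affine_line_approximation _ f K c0 gam rho E1 T c00 gam0 rho0 E10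
    ltac:(lra) cK fL fl.
apply: (@close_seam _ f g K c0 gam rho T E1 (E1 * q) E) => //.
- rewrite /q; have -> : gam * (gam * (E1 * ((K + 2 * gam) / gam / gam))) =
    E1 * (K + 2 * gam) by field; rewrite gt_eqF.
  by lra.
- by apply: le_trans D1 _; rewrite ge_min lexx.
- have E1E : E1 <= E / 2 by rewrite ge_min lexx.
  have : (2 * K + gam) * (E1 * q) <= E / 2.
    rewrite mulrC -ler_pdivlMr; last lra.
    by apply: le_trans D1 _; rewrite ge_min lexx orbT.
  lra.
Qed.

(** * The circle *)

Section CircleGeometry.
Context {R : realType}.
Implicit Types (s t x b : R) (p : circle R).

Lemma sin_mvt x : 0 < x -> exists2 c, 0 < c < x & sin x = cos c * x.
Proof.
move=> x0.
have [|c cI] := @MVT R sin cos 0 x x0.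
  by apply: continuous_subspaceT; exact: continuous_sin.
by rewrite sin0 !subr0 => ->; exists c.
Qed.

Lemma ler_norm_sin x : `|sin x| <= `|x|.
Proof.
wlog x0 : x / 0 < x => [h|].
  have [/h//|x_lt0|<-] := ltgtP 0 x; last by rewrite sin0.
  by rewrite -normrN -sinN -[leRHS]normrN; apply: h; rewrite oppr_gt0.
have [c _ ->] := sin_mvt x0.
by rewrite normrM ler_piMl// cos_max.
Qed.

(** By the mean value theorem [sin x = cos c * x] with [c < x], and [cos c = 1 - 2 sin^2 (c / 2) >=
    1 - c^2 / 2]. *)
Lemma sin_lower x : 0 <= x -> x * (1 - x ^+ 2 / 2) <= sin x.
Proof.
rewrite le_eqVlt => /predU1P[<-|x0]; first by rewrite mul0r sin0.
have [c /andP[c0 cx] ->] := sin_mvt x0.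
rewrite mulrC ler_pM2r//.
have := cos_mulr2n (c / 2); rewrite cos2sin2.
have -> : (c / 2) *+ 2 = c by rewrite mulr2n; lra.
move=> ->.
have : `|sin (c / 2)| ^+ 2 <= `|c / 2| ^+ 2.
  by rewrite ler_pXn2r ?nnegrE ?normr_ge0// ler_norm_sin.
rewrite !real_normK ?num_real//.
have : c ^+ 2 <= x ^+ 2 by rewrite ler_pXn2r ?nnegrE ?ltW.
lra.
Qed.

Lemma chord_arc (eta : R) : eta < 1 ->
  exists2 rho, 0 < rho <= 1 &
    forall d : R, 0 <= d <= rho -> eta * d <= 2 * sin (d / 2) <= d.
Proof.
(* Since [2 * sin (d / 2) >= d * (1 - d^2 / 8)], it is enough that [d^2 <= d <= 8 * (1 - eta)]. *)
move=> eta1; exists (Num.min 1 (8 * (1 - eta))).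
  by rewrite ge_min lexx lt_min ltr01/= andbT mulr_gt0// subr_gt0.
move=> d; rewrite le_min => /and3P[d0 d1 deta].
have := sin_lower (x := d / 2) ltac:(lra).
have := le_trans (ler_norm _) (ler_norm_sin (d / 2)).
rewrite [`|d / 2|]ger0_norm; last lra.
have : 0 <= d * (8 * (1 - eta) - d) by rewrite mulr_ge0// subr_ge0.
have : 0 <= d ^+ 2 * (1 - d) by rewrite mulr_ge0 ?sqr_ge0// subr_ge0.
move=> *; apply/andP; split; nra.
Qed.

Lemma enorm_circle_ptB s t :
  enorm (val (circle_pt s) - val (circle_pt t)) = 2 * `|sin ((t - s) / 2)|.
Proof.
rewrite /enorm /=.
have -> : (cos s - cos t) ^+ 2 + (sin s - sin t) ^+ 2 =
    (2 * sin ((t - s) / 2)) ^+ 2.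
  have := cos_mulr2n ((t - s) / 2); rewrite cos2sin2.
  have -> : ((t - s) / 2) *+ 2 = t - s by rewrite mulr2n; lra.
  rewrite cosB.
  have := cos2Dsin2 s; have := cos2Dsin2 t.
  nra.
by rewrite sqrtr_sqr normrM ger0_norm.
Qed.

Lemma circle_ptD2pi t : circle_pt (t + 2 * pi) = circle_pt t.
Proof.
by apply: val_inj; rewrite /= mulr_natl cosD2pi sinD2pi.
Qed.

Lemma circle_ptD s t x :
  circle_pt s = circle_pt t -> circle_pt (s + x) = circle_pt (t + x).
Proof.
move=> /(congr1 val) /= [cst sst].
by apply: val_inj; rewrite /= !cosD !sinD cst sst.
Qed.

Lemma circle_pt_surj p : exists t, circle_pt t = p.
Proof.
case: p => -[u v] uv1.
have uv : u ^+ 2 + v ^+ 2 = 1.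
  by have := sqr_enorm (u, v); rewrite (eqP uv1) expr1n.
have u1 : -1 <= u <= 1.
    rewrite -ler_norml -(@ler_pXn2r _ 2) ?nnegrE// real_normK ?num_real// expr1n.
    by rewrite -uv lerDl sqr_ge0.
have su : sin (acos u) = `|v|.
  by rewrite sin_acos// -[1]uv [u ^+ 2 + _]addrC addrK sqrtr_sqr.
have cu : cos (acos u) = u by rewrite acosK// in_itv.
have [v0|v0] := leP 0 v.
  by exists (acos u); apply: val_inj; rewrite /= su cu ger0_norm.
by exists (- acos u); apply: val_inj; rewrite /= sinN cosN su cu ltr0_norm// opprK.
Qed.

Lemma circle_pt_angle p b : exists2 t, b <= t < b + 2 * pi & circle_pt t = p.
Proof.
have [t0 <-] := circle_pt_surj p.
have pi2 : 0 < 2 * pi :> R by rewrite mulr_gt0// pi_gt0.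
have cpn n t : circle_pt (t + n%:R * (2 * pi)) = circle_pt t.
  elim: n => [|n ih]; first by rewrite mul0r addr0.
  by rewrite -natr1 mulrDl mul1r addrA circle_ptD2pi.
pose k := Num.floor ((t0 - b) / (2 * pi)).
have /andP[kl ku] : k%:~R <= (t0 - b) / (2 * pi) < (k + 1)%:~R by exact: floor_itv.
rewrite ler_pdivlMr// in kl; rewrite ltr_pdivrMr// intrD mulrDl in ku.
exists (t0 - k%:~R * (2 * pi)); first by apply/andP; split; lra.
case: k {kl ku} => n; first by rewrite -[LHS](cpn n) subrK.
by rewrite NegzE mulrNz mulNr opprK cpn.
Qed.

Lemma circle_pt_inj s t : `|s - t| < 2 * pi -> circle_pt s = circle_pt t -> s = t.
Proof.
wlog st : s t / s <= t => [h|].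
  by have [/h//|/ltW ts] := leP s t; rewrite distrC => /(h _ _ ts) h' /esym/h'.
rewrite distrC ger0_norm ?subr_ge0// => stpi e.
have := enorm_circle_ptB s t; rewrite e subrr.
have /eqP -> : enorm (0 : R * R) == 0 by rewrite /enorm/= expr0n addr0 sqrtr0.
move=> /esym/eqP; rewrite mulf_eq0 pnatr_eq0/= normr_eq0 => /eqP s0.
move: st; rewrite le_eqVlt => /predU1P[//|st].
have : 0 < sin ((t - s) / 2) by apply: sin_gt0_pi; apply/andP; split; lra.
by rewrite s0 ltxx.
Qed.

(** Ordering the pair along its shorter arc makes the chord [2 * sin ((t - s) / 2)], increasing in
    [t - s]. The price is that [t] may pass [b + 2 * pi]. *)
Lemma circle_pt_pair b p q : exists s t,
  [/\ b <= s < b + 2 * pi, s <= t <= s + pi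
    & (p = circle_pt s /\ q = circle_pt t) \/ (q = circle_pt s /\ p = circle_pt t)].
Proof.
have pi0 := pi_gt0 R.
have [s /andP[bs sb] <-] := circle_pt_angle p b.
have [t /andP[st ts] <-] := circle_pt_angle q (s - pi).
have /orP[s_t|t_s] := le_total s t.
  by exists s, t; split; [lra|lra|left].
have [bt|tb] := leP b t.
  by exists t, s; split; [lra|lra|right].
exists (t + 2 * pi), (s + 2 * pi); split; [lra|lra|right].
by rewrite !circle_ptD2pi.
Qed.

End CircleGeometry.

Lemma Linfty_norm_le (R : realType) (f : circle R -> R * R) (e : R) :
  0 <= e -> (forall p, enorm (f p) <= e) -> (Linfty_norm f <= e%:E)%E.
Proof.
move=> e0 fe; rewrite /Linfty_norm unlock.
(* The norm at [+oo] has a default branch of value [0], settled by [0 <= e]; the other branch is an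
   essential supremum. *)
case: ifPn => _; last by rewrite lee_fin.
apply: ess_sup_inf.ess_sup_ler => t; rewrite lee_fin ger0_norm ?enorm_ge0//.
Qed.

(** * From curves on the line to maps on the circle *)

Section Wrap.
Context {R : realType}.
Variables (G : R -> R * R) (b k : R).
Implicit Types (t : R) (p : circle R).

Definition angle p : R := s2val (cid2 (circle_pt_angle p b)).

Lemma angle_itv p : b <= angle p < b + 2 * pi.
Proof. exact: (s2valP (cid2 (circle_pt_angle p b))). Qed.

Lemma circle_ptK p : circle_pt (angle p) = p.
Proof. exact: (s2valP' (cid2 (circle_pt_angle p b))). Qed.

Definition wrap p : R * R := G (angle p).

(** The overlap [k] lets short arcs that cross the cut at angle [b] be computed on [G] itself. *)
Lemma wrapE t : k < 2 * pi ->
  (forall t, b + 2 * pi <= t <= b + 2 * pi + k -> G t = G (t - 2 * pi)) ->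
  b <= t <= b + 2 * pi + k -> wrap (circle_pt t) = G t.
Proof.
move=> k2 GT.
have base u : b <= u < b + 2 * pi -> wrap (circle_pt u) = G u.
  move=> ub; congr G; apply: circle_pt_inj (circle_ptK _).
  by have := angle_itv (circle_pt u); rewrite ltr_norml; lra.
move=> /andP[bt tb]; have [tlt|tge] := ltP t (b + 2 * pi).
  by apply: base; rewrite bt.
rewrite GT ?tge// -base; last by apply/andP; split; lra.
by rewrite -[in LHS](subrK (2 * pi) t) circle_ptD2pi.
Qed.

(** An interval shorter than one turn, moved so as to start in [[b, b + 2 * pi[], lies within two
    turns from [b]. *)
Lemma finitely_piecewise_linear_wrap : 0 <= k < 2 * pi ->
  (forall t, b + 2 * pi <= t <= b + 2 * pi + k -> G t = G (t - 2 * pi)) ->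
  piecewise_affine G b (b + 2 * pi) -> finitely_piecewise_linear wrap.
Proof.
move=> /andP[k0 k2] GT Gpa u v uv uv2.
apply: piecewise_affine_finitely_piecewise_linear.
have pi0 := pi_gt0 R.
pose H t := wrap (circle_pt t).
have Hpa : piecewise_affine H b (b + 2 * pi).
  apply: eq_piecewise_affine Gpa => t /andP[bt tb]; rewrite /H wrapE//.
  by rewrite bt/=; lra.
have {}Hpa : piecewise_affine H b (b + 2 * pi + 2 * pi).
  apply: piecewise_affine_cat (Hpa) _.
  by apply: piecewise_affine_shift Hpa => t; rewrite /H circle_ptD2pi.
have [w /andP[bw wb]] := circle_pt_angle (circle_pt u) b.
have := @piecewise_affine_restrict _ _ b w (w + (v - u)) (b + 2 * pi + 2 * pi) bw
  ltac:(lra) ltac:(lra) Hpa.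
move=> + uw => /(@piecewise_affine_shift _ _ H _ _ (u - w)).
have -> : w + (u - w) = u by ring.
have -> : w + (v - u) + (u - w) = v by ring.
apply=> t; rewrite /H; congr wrap.
have -> : t + (u - w) = u + (t - w) by ring.
by rewrite -(circle_ptD (t - w) uw); congr circle_pt; ring.
Qed.

End Wrap.

(** * Choice of constants and the global estimate *)

Theorem theorem5p2 (R : realType) (L : R) (phi : circle R -> R * R) (eps : R)
    (hphi : bilipschitz L phi) (heps : 0 < eps) :
  exists phi_eps : circle R -> R * R,
    [/\ finitely_piecewise_linear phi_eps,
        bilipschitz (L + eps) phi_eps
      & (Linfty_norm (fun x => (phi x - phi_eps x)%R) <= eps%:E)%E].
Proof.
case: hphi => L0 philip.
have pi0 := pi_gt0 R; have pi2 := pi_ge2 R.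
set l := L^-1 in philip.
have l0 : 0 < l by rewrite invr_gt0.
have lL : l * L = 1 by rewrite mulVf// gt_eqF.
have Le0 : 0 < L + eps by rewrite addr_gt0.
pose l' := (L + eps)^-1.
have l'E : l' = (L + eps)^-1 by [].
have l'0 : 0 < l' by rewrite invr_gt0.
have l'L : l' * (L + eps) = 1 by rewrite mulVf// gt_eqF.
have ll' : l' < l by rewrite ltf_pV2 ?posrE//; lra.
(* An antipodal pair has nonzero chord, so the two bounds on it can be compared. *)
have l_le_L : l <= L.
  have /andP[h1 h2] := philip (circle_pt 0) (circle_pt pi).
  have := le_trans h1 h2.
  by rewrite enorm_circle_ptB subr0 sin_pihalf normr1 ler_pM2r ?mulr1.
clearbody l l'.
(* The ratio of chord to arc that spends half of the slack on each side: [l * eta] is the midpoint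
   of [l] and [l'], and [(L + eps) * eta = L + eps / 2]. *)
pose eta := (l + l') / 2 * L.
have eta0 : 0 < eta by rewrite !(mulr_gt0, divr_gt0, addr_gt0).
have eta1 : eta < 1.
  have : 0 < (l - l') * L by rewrite mulr_gt0// subr_gt0.
  by rewrite /eta; lra.
have l_eta : l * eta = (l + l') / 2.
  have -> : l * eta = (l * L) * ((l + l') / 2) by rewrite /eta; ring.
  by rewrite lL mul1r.
have Le_eta : (L + eps) * eta = L + eps / 2.
  have -> : (L + eps) * eta = ((L + eps) * (l * L) + (l' * (L + eps)) * L) / 2.
    by rewrite /eta; field.
  by rewrite lL l'L; field.
clearbody eta.
have [rho /andP[rho0 rho1] arc] := chord_arc eta1.
(* This keeps [c0 = (l + l') / 2 - 2 * gam >= l'] and [L + gam <= L + eps / 2]. *)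
pose gam := Num.min ((l - l') / 4) (eps / 2).
have gam0 : 0 < gam by rewrite lt_min !divr_gt0// subr_gt0.
have gam_l : gam <= (l - l') / 4 by rewrite ge_min lexx.
have gam_eps : gam <= eps / 2 by rewrite ge_min lexx orbT.
clearbody gam.
(* A lower bound for the chord of two points more than [rho / 8] apart in angle. [E] is chosen so
   that an error [2 * E] in a distance fits into the slack at chord length [d0]. *)
pose d0 := eta * (rho / 8).
have d00 : 0 < d0 by rewrite mulr_gt0// divr_gt0.
pose E := Num.min eps (Num.min (d0 * (l - l') / 2) (d0 * eps / 2)).
have E0 : 0 < E by rewrite !lt_min heps !divr_gt0// mulr_gt0// subr_gt0.
have E_eps : E <= eps by rewrite ge_min lexx.
have E_l : 2 * E <= d0 * (l - l').
  by rewrite mulrC -ler_pdivlMr// !ge_min lexx orbT.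
have E_L : 2 * E <= d0 * eps.
  by rewrite mulrC -ler_pdivlMr// !ge_min lexx !orbT.
clearbody E.
pose f t := phi (circle_pt t).
have fL : lipschitz_line L f.
  move=> s t st; have /andP[_] := philip (circle_pt s) (circle_pt t).
  move=> /le_trans; apply; rewrite ler_pM2l// enorm_circle_ptB.
  have := ler_norm_sin ((t - s) / 2); rewrite [`|(t - s) / 2|]ger0_norm; lra.
have fT t : f (t - 2 * pi) = f t by rewrite /f -circle_ptD2pi subrK.
have fl s t : s <= t -> t - s <= rho ->
    ((l + l') / 2 - 2 * gam + 2 * gam) * (t - s) <= eudist (f s) (f t).
  move=> st tsr; have /andP[+ _] := philip (circle_pt s) (circle_pt t).
  apply: le_trans; rewrite subrK -l_eta -mulrA ler_pM2l// enorm_circle_ptB.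
  have /andP[/le_trans h _] := arc (t - s) ltac:(lra).
  by apply: h; rewrite ler_pM2l// ler_norm.
have [G [b [GL Gl GE GT Gpa]]] := @periodic_piecewise_affine_approximation _ f L
  ((l + l') / 2 - 2 * gam) gam rho E (2 * pi) ltac:(lra) gam0 rho0 E0
  ltac:(lra) ltac:(lra) fL fT fl.
have wE := @wrapE _ G b (rho / 8) _ ltac:(lra) GT.
have close p : eudist (wrap G b p) (phi p) <= E.
  by rewrite -{2}(circle_ptK b p); exact: GE.
exists (wrap G b); split.
- by apply: (@finitely_piecewise_linear_wrap _ _ _ (rho / 8)) => //; lra.
- split=> //; rewrite -l'E.
  suff core s t : b <= s < b + 2 * pi -> s <= t <= s + pi ->
      l' * eudist (val (circle_pt s)) (val (circle_pt t))
        <= eudist (wrap G b (circle_pt s)) (wrap G b (circle_pt t))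
        <= (L + eps) * eudist (val (circle_pt s)) (val (circle_pt t)).
    move=> x y; have [s [t [sb st []]]] := circle_pt_pair b x y => -[-> ->].
      exact: core s t sb st.
    have := core s t sb st.
    by rewrite [eudist (val _) _]eudistC [eudist (wrap _ _ _) _]eudistC.
  move=> /andP[bs sb] /andP[st ts].
  set d := eudist (val (circle_pt s)) (val (circle_pt t)).
  have dE : d = 2 * sin ((t - s) / 2).
    rewrite /d /eudist enorm_circle_ptB ger0_norm// sin_ge0_pi//.
    by apply/andP; split; lra.
  have [near|far] := leP (t - s) (rho / 8).
    rewrite !wE; [|lra|lra].
    have := arc (t - s) ltac:(lra); rewrite -dE => /andP[d_ge d_le].
    have := GL s t st; have := Gl s t st near => G_ge G_le.
    apply/andP; split.
      apply: le_trans G_ge.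
      have : l' * d <= l' * (t - s) by rewrite ler_pM2l.
      have : l' * (t - s) <= ((l + l') / 2 - 2 * gam) * (t - s).
        by apply: ler_wpM2r; lra.
      lra.
    apply: le_trans G_le _.
    have : (L + eps) * (eta * (t - s)) <= (L + eps) * d by rewrite ler_pM2l.
    rewrite mulrA Le_eta.
    have : (L + gam) * (t - s) <= (L + eps / 2) * (t - s).
      by apply: ler_wpM2r; lra.
    lra.
  (* Far pairs: [sin] increases up to [pi / 2], so the chord exceeds that of the arc [rho / 8], and
     closeness to [phi] is enough. *)
  have d_ge : d0 <= d.
    have /andP[h _] := arc (rho / 8) ltac:(lra).
    apply: le_trans h _; rewrite dE ler_pM2l//.
    by rewrite ltW// ltr_sin ?in_itv/=; lra.
  have /andP[] := philip (circle_pt s) (circle_pt t).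
  rewrite -[enorm (val _ - val _)]/d -[enorm _]/(eudist _ _).
  have := close (circle_pt s); have := close (circle_pt t).
  have := ler_dist_eudist (wrap G b (circle_pt s)) (phi (circle_pt s))
    (wrap G b (circle_pt t)) (phi (circle_pt t)).
  rewrite ler_norml => /andP[? ?] ? ? ? ?.
  have : d0 * (l - l') <= d * (l - l') by apply: ler_wpM2r; lra.
  have : d0 * eps <= d * eps by apply: ler_wpM2r; lra.
  move=> *; apply/andP; split; lra.
- apply: Linfty_norm_le => [|p]; first exact: ltW.
  by apply: le_trans E_eps; have := close p; rewrite eudistC.
Qed.
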